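(* Let $\mathbb{F}$ be a finite field of characteristic $2$. There is an algorithm which, given a multilinear polynomial $P\in\mathbb{F}[x_1,\dots,x_m]$, returns a symmetric matrix $M$ with entries in $\mathbb{F}\cup\{x_1,\dots,x_m\}$ such that $\det(M)=P$ whenever such a matrix exists. The algorithm runs in time polynomial in $m$ and in the number of monomials of $P$.
   Context: A polynomial is multilinear if each of its monomials has degree at most $1$ in each variable. *)

(* Defs.v *)
From mathcomp Require Import all_boot all_algebra.
From mathcomp Require Import mpoly.

Set Implicit Arguments.
Unset Strict Implicit.
Unset Printing Implicit Defensive.

Import GRing.Theory.
Local Open Scope ring_scope.

(* Programs of a first-order Lisp over binary trees, with general recursion
   (compare the languages WHILE and F of N. D. Jones, "Computability and
   Complexity from a Programming Perspective").

   The running time is the number of expression evaluations.  Values are only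
   built and inspected one constructor at a time (there is no equality test on
   trees and no arithmetic), so each evaluation step is a constant number of
   pointer operations on a heap: a run of t steps allocates at most t cells and
   is simulated by a Turing machine in time polynomial in t and in the size of
   the input. *)

Inductive tree := Leaf | Node of tree & tree.

Definition hd (t : tree) : tree := if t is Node l _ then l else Leaf.
Definition tl (t : tree) : tree := if t is Node _ r then r else Leaf.

Inductive expr :=
| Var of nat                   (* de Bruijn index into the environment *)
| Nil
| Cons of expr & expr
| Hd of expr
| Tl of expr
| If of expr & expr & expr     (* [Leaf] is false, every [Node] is true *)
| Let of expr & expr           (* binds index 0 in the second expression *)
| Call of nat & expr.

(* A program is the finite list of the bodies of its functions.  Functions are
   unary: index 0 in a body is the argument.  The entry point is function 0. *)
Definition program := seq expr.

(* [eval p env e v t]: in program [p] and environment [env], the expression [e]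
   evaluates (call by value) to [v] in [t] steps.  Divergence is the absence
   of a derivation. *)
Inductive eval (p : program) : seq tree -> expr -> tree -> nat -> Prop :=
| EvVar env i : eval p env (Var i) (nth Leaf env i) 1
| EvNil env : eval p env Nil Leaf 1
| EvCons env e1 e2 v1 v2 t1 t2 :
    eval p env e1 v1 t1 -> eval p env e2 v2 t2 ->
    eval p env (Cons e1 e2) (Node v1 v2) (t1 + t2).+1
| EvHd env e v t : eval p env e v t -> eval p env (Hd e) (hd v) t.+1
| EvTl env e v t : eval p env e v t -> eval p env (Tl e) (tl v) t.+1
| EvIfT env e e1 e2 l r v t t' :
    eval p env e (Node l r) t -> eval p env e1 v t' ->
    eval p env (If e e1 e2) v (t + t').+1
| EvIfF env e e1 e2 v t t' :
    eval p env e Leaf t -> eval p env e2 v t' ->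
    eval p env (If e e1 e2) v (t + t').+1
| EvLet env e1 e2 v1 v2 t1 t2 :
    eval p env e1 v1 t1 -> eval p (v1 :: env) e2 v2 t2 ->
    eval p env (Let e1 e2) v2 (t1 + t2).+1
| EvCall env f e a v t t' :
    eval p env e a t -> eval p [:: a] (nth Nil p f) v t' ->
    eval p env (Call f e) v (t + t').+1.

Definition runs (p : program) (input output : tree) (t : nat) : Prop :=
  eval p [:: input] (nth Nil p 0) output t.

Lemma eval_det p env e v t v' t' :
  eval p env e v t -> eval p env e v' t' -> v = v' /\ t = t'.
Proof.
move=> ev; elim: ev v' t' => {env e v t};
  intros; match goal with H : eval _ _ _ ?v' ?t' |- _ = ?v' /\ _ = ?t' =>
    inversion H; clear H; subst end;
  repeat match goal with
    IH : (forall v t, eval _ ?env ?e v t -> _), H : eval _ ?env ?e _ _ |- _ =>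
      case: (IH _ _ H) => ? ?; clear H; subst
  end; by [].
Qed.

Section Algebra.

Variables (F : finFieldType) (m : nat).

Definition multilinear (P : {mpoly F[m]}) : Prop :=
  forall (mon : 'X_{1..m}) (i : 'I_m), mon \in msupp P -> (mon i <= 1)%N.

(* The matrix entries F \cup {x_1, ..., x_m}, as names that [poly_of_entry]
   maps injectively to polynomials. *)
Definition entry : Type := (F + 'I_m)%type.

Definition poly_of_entry (e : entry) : {mpoly F[m]} :=
  match e with inl a => a%:MP | inr i => 'X_i end.

Definition symmetric_representation (n : nat) (P : {mpoly F[m]})
    (A : 'M[entry]_n) : Prop :=
  A^T = A /\ \det (map_mx poly_of_entry A) = P.

End Algebra.

Definition enc_seq (T : Type) (enc : T -> tree) (s : seq T) : tree :=
  foldr (fun x t => Node (enc x) t) Leaf s.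

Definition enc_nat (k : nat) : tree := iter k (Node Leaf) Leaf.

Section Encodings.

Variables (F : finFieldType) (m : nat).

Definition enc_scalar (a : F) : tree := enc_nat (enum_rank a).

Definition enc_monomial (mon : 'X_{1..m}) : tree :=
  enc_seq (fun i => enc_nat (mon i)) (enum 'I_m).

(* Sparse representation: [m] together with the pairs (coefficient, exponent
   vector) of the monomials of [P], in the order in which [s] lists them. *)
Definition enc_poly (P : {mpoly F[m]}) (s : seq 'X_{1..m}) : tree :=
  Node (enc_nat m)
       (enc_seq (fun mon => Node (enc_scalar P@_mon) (enc_monomial mon)) s).

Definition enc_entry (e : entry F m) : tree :=
  match e with
  | inl a => Node Leaf (enc_scalar a)
  | inr i => Node (Node Leaf Leaf) (enc_nat i)
  end.

Definition enc_matrix (n : nat) (A : 'M[entry F m]_n) : tree :=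
  enc_seq (fun i => enc_seq (fun j => enc_entry (A i j)) (enum 'I_n))
          (enum 'I_n).

End Encodings.

(* Main.v *)
(* Let [A] be a symmetric representation of [P] and [l] a point of {0, 1}^m with
   [P(l) = c != 0].  In characteristic 2 the determinant of a symmetric matrix is a
   sum over involutions, so it only depends on the diagonal and on the squares of the
   off-diagonal entries.  Modulo the squares [(x_i - l_i)^2] every off-diagonal entry
   squares to a constant, and [P] becomes [c det(I + diag(x - l) B)] for a symmetric
   scalar matrix [B]; both sides are multilinear, so this is an equality.  Evaluating
   it at [l + e_i] and [l + e_i + e_j] determines the entries of [B], which are thus
   square roots of explicit expressions in values of [P] at 0/1 points.  Conversely
   [c det(I + diag(x - l) B)] is represented by a matrix of size [3 m + 1] through
   Schur complements.  The value of [P] at a 0/1 point is a sum of coefficients, and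
   some monomial of [P != 0] has a support at which [P] does not vanish.  Nothing has
   to be checked: if [P] has no representation, any output is acceptable. *)
From HB Require Import structures.
Require Import Defs.
From mathcomp Require Import all_boot all_algebra fingroup perm.
From mathcomp Require Import mpoly ring.
From mathcomp Require Import zify.

Set Implicit Arguments.
Unset Strict Implicit.
Unset Printing Implicit Defensive.

Import Defs GRing.Theory.
Local Open Scope ring_scope.

Lemma sum_involution_pchar2 (R : nzRingType) (T : finType) (g : T -> T)
    (P : pred T) (f : T -> R) :
    2%N \in [pchar R] -> involutive g ->
    (forall x, P (g x) = P x) -> (forall x, f (g x) = f x) ->
    (forall x, P x -> g x != x) ->
  \sum_(x | P x) f x = 0.
Proof.
move=> charR gK Pg fg gP.
rewrite (bigID (fun x => (enum_rank x < enum_rank (g x))%N)) /=.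
rewrite [X in _ + X](reindex_inj (inv_inj gK)) /=.
rewrite [X in _ + X](eq_bigl (fun x => P x && (enum_rank x < enum_rank (g x))%N)).
  by rewrite [X in _ + X](eq_bigr f) ?addrr_pchar2.
move=> x; rewrite Pg gK -leqNgt leq_eqVlt; case: (boolP (P x)) => //= Px.
case: eqP => // /val_inj/enum_rank_inj/eqP.
by rewrite eq_sym (negPf (gP x Px)).
Qed.

(* The terms of [s] and [s^-1] cancel, so that only involutions remain. *)
Lemma det_sym_pchar2 (R : comNzRingType) n (M : 'M[R]_n) :
    2%N \in [pchar R] -> M^T = M ->
  \det M = \sum_(s : 'S_n | (s^-1 == s)%g)
             ((\prod_(i : 'I_n | s i == i) M i i) * \prod_(i : 'I_n | (i < s i)%N) M i (s i) ^+ 2).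
Proof.
move=> charR Msym.
have symE i j : M i j = M j i by rewrite -{1}Msym mxE.
have signE (s : 'S_n) x : (-1) ^+ s * x = x :> R.
  by rewrite (oppr_pchar2 charR) expr1n mul1r.
rewrite /determinant (bigID (fun s : 'S_n => (s^-1 == s)%g)) /=.
rewrite [X in _ + X](sum_involution_pchar2 (g := invg)) ?addr0 //.
- apply: eq_bigr => s /eqP sV; rewrite signE.
  have sK i : s (s i) = i by rewrite -{1}sV permK.
  rewrite (bigID (fun i => s i == i)) /=; congr (_ * _).
    by apply: eq_bigr => i /eqP->.
  rewrite (bigID (fun i : 'I_n => (i < s i)%N)) /=.
  rewrite [X in _ * X](reindex_inj (@perm_inj _ s)) /=.
  rewrite [X in _ * X](eq_bigl (fun i : 'I_n => (s i != i) && (i < s i)%N)).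
    rewrite -big_split /=; apply: eq_big => i.
      by case: ltngtP => [||/val_inj<-]; rewrite ?eqxx ?andbF // -val_eqE neq_ltn => ->; rewrite ?orbT.
    by rewrite sK (symE (s i)) expr2.
  move=> i; rewrite sK -leqNgt eq_sym; case: eqVneq => //= Ni.
  by rewrite leq_eqVlt val_eqE eq_sym (negPf Ni).
- exact: invgK.
- by move=> s; rewrite invgK eq_sym.
- move=> s; rewrite !signE (reindex_inj (@perm_inj _ s)) /=.
  by apply: eq_bigr => i _; rewrite permK symE.
Qed.

Lemma pchar2_mpoly (R : comNzRingType) m :
  2%N \in [pchar R] -> 2%N \in [pchar {mpoly R[m]}].
Proof. by move=> charR; rewrite inE /= -mpolyC_nat (pcharf0 charR) mpolyC0 eqxx. Qed.

Section Multilinear.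

Variables (R : comNzRingType) (m : nat).
Implicit Types p q : {mpoly R[m]}.

(* Congruence modulo the squares of the variables. *)
Definition eqml p q :=
  forall k : 'X_{1..m}, (forall i, (k i <= 1)%N) -> p@_k = q@_k.

Lemma eqml_add p q p' q' : eqml p q -> eqml p' q' -> eqml (p + p') (q + q').
Proof. by move=> e e' k k1; rewrite !mcoeffD e ?e'. Qed.

Lemma eqml_mul p q p' q' : eqml p q -> eqml p' q' -> eqml (p * p') (q * q').
Proof.
move=> e e' k k1; rewrite !mcoeffM; apply: eq_bigr => -[k2 k3] /= /eqP kE.
have le1 i : (k2 i + k3 i <= 1)%N by rewrite -mnmDE -kE.
by rewrite e ?e' // => i; apply: leq_trans (le1 i); rewrite (leq_addr, leq_addl).
Qed.

Lemma eqml_sqr_pchar2 p q :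
  2%N \in [pchar R] -> p@_0%MM = q@_0%MM -> eqml (p ^+ 2) (q ^+ 2).
Proof.
move=> charR; have charP := pchar2_mpoly m charR.
suff sqrE (r : {mpoly R[m]}) (k : 'X_{1..m}) : (forall i, (k i <= 1)%N) ->
    (r ^+ 2)@_k = (r@_0%MM) ^+ 2 * (k == 0%MM)%:R.
  by move=> e k k1; rewrite !sqrE // e.
move=> k1; rewrite {1}[r]mpolyE -(pFrobenius_autE charP) raddf_sum /=.
rewrite raddf_sum /=.
have termE j : j \in msupp r ->
    (pFrobenius_aut charP (r@_j *: 'X_[j]))@_k
    = (j == 0%MM)%:R * (r@_0%MM ^+ 2 * (k == 0%MM)%:R).
  move=> _; rewrite pFrobenius_autE exprZn mcoeffZ mcoeffXn.
  have [->|Nj] := eqVneq j 0%MM; first by rewrite mul1r eq_sym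
    (_ : (0 *+ 2)%MM = 0%MM) //; apply/mnmP=> i; rewrite mulmnE mnm0E.
  have [i ji] : exists i, j i != 0%N.
    by apply/existsP; apply: contraR Nj => /existsPn ji; apply/eqP/mnmP => i;
       rewrite mnm0E; apply/eqP/negPn/ji.
  case: eqP => [kE|_]; last by rewrite mulr0 mul0r.
  by move: (k1 i) ji; rewrite -kE mulmnE; lia.
rewrite (eq_big_seq _ termE) -mulr_suml.
have [r0|r0] := boolP (0%MM \in msupp r).
  rewrite (bigD1_seq 0%MM) ?msupp_uniq //= big1 ?addr0 ?eqxx ?mul1r //.
  by move=> j /negPf->.
by rewrite (memN_msupp_eq0 r0) expr0n /= mul0r mulr0.
Qed.

Lemma eqml_det_pchar2 n (M N : 'M[{mpoly R[m]}]_n) :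
    2%N \in [pchar R] -> M^T = M -> N^T = N ->
    (forall i, M i i = N i i) ->
    (forall i j, (M i j)@_0%MM = (N i j)@_0%MM) ->
  eqml (\det M) (\det N).
Proof.
move=> charR Ms Ns Md M0; have charP := pchar2_mpoly m charR.
rewrite !det_sym_pchar2 //; apply: big_ind2 => [||s _] //.
  by move=> ? ? ? ?; apply: eqml_add.
apply: eqml_mul; first by under eq_bigr do rewrite Md.
apply: big_ind2 => [||i _] //; first by move=> ? ? ? ?; apply: eqml_mul.
exact: eqml_sqr_pchar2.
Qed.

End Multilinear.

Section DegreeIn.

Variables (R : comNzRingType) (m : nat) (i : 'I_m).
Implicit Types p q : {mpoly R[m]}.

Definition degX_le (d : nat) p := forall k, k \in msupp p -> (k i <= d)%N.

Lemma degX_leC d c : degX_le d c%:MP.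
Proof.
by move=> k; rewrite msuppC; case: eqP => // _; rewrite inE => /eqP->; rewrite mnm0E.
Qed.

Lemma degX_leX j : degX_le (j == i) 'X_j.
Proof. by move=> k; rewrite msuppX inE => /eqP->; rewrite mnm1E. Qed.

Lemma degX_le_trans d e p : (d <= e)%N -> degX_le d p -> degX_le e p.
Proof. by move=> de dp k /dp kd; apply: leq_trans de. Qed.

Lemma degX_leD d p q : degX_le d p -> degX_le d q -> degX_le d (p + q).
Proof. by move=> dp dq k /msuppD_le; rewrite mem_cat => /orP[/dp|/dq]. Qed.

Lemma degX_leM d e p q : degX_le d p -> degX_le e q -> degX_le (d + e) (p * q).
Proof.
move=> dp dq k /msuppM_le/allpairsP[[k1 k2] /= [/dp k1d /dq k2e ->]].
by rewrite mnmDE leq_add.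
Qed.

Lemma degX_le_sum d (I : Type) (r : seq I) (Q : pred I) (f : I -> {mpoly R[m]}) :
  (forall j, Q j -> degX_le d (f j)) -> degX_le d (\sum_(j <- r | Q j) f j).
Proof.
move=> df; apply: (big_ind (degX_le d)) => //; last by move=> ? ?; apply: degX_leD.
by rewrite -mpolyC0; apply: degX_leC.
Qed.

Lemma degX_le_prod (I : Type) (r : seq I) (Q : pred I) (f : I -> {mpoly R[m]}) d :
    (forall j, Q j -> degX_le (d j) (f j)) ->
  degX_le (\sum_(j <- r | Q j) d j) (\prod_(j <- r | Q j) f j).
Proof.
move=> df; apply: (big_ind2 degX_le) => //; last by move=> ? ? ? ?; apply: degX_leM.
by rewrite -mpolyC1; apply: degX_leC.
Qed.

Lemma degX_le_exp d p n : degX_le d p -> degX_le (n * d) (p ^+ n).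
Proof.
move=> dp; elim: n => [|n IH]; first by rewrite expr0 -mpolyC1; apply: degX_leC.
by rewrite exprS mulSn; apply: degX_leM.
Qed.

Lemma degX_le_det n (M : 'M[{mpoly R[m]}]_n) d :
  (forall r s, degX_le (d r) (M r s)) -> degX_le (\sum_r d r) (\det M).
Proof.
move=> dM; apply: degX_le_sum => s _; rewrite -[X in degX_le X]add0n.
apply: degX_leM; last by apply: degX_le_prod => r _.
by rewrite -(rmorph_sign (@mpolyC m R)); apply: degX_leC.
Qed.

End DegreeIn.

Lemma eqml_multilinear_eq (R : comNzRingType) m (p q : {mpoly R[m]}) :
    (forall i, degX_le i 1 p) -> (forall i, degX_le i 1 q) -> eqml p q ->
  p = q.
Proof.
move=> p1 q1 e; apply/mpolyP=> k.
have [/forallP k1|] := boolP [forall i, (k i <= 1)%N]; first exact: e.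
rewrite negb_forall => /existsP[i ki]; rewrite !memN_msupp_eq0 //.
  by apply: contra ki => /q1; apply.
by apply: contra ki => /p1; apply.
Qed.

Section Translate.

Variables (R : comNzRingType) (m : nat).
Implicit Types (p : {mpoly R[m]}) (l : 'I_m -> R).

Definition translate l p := p \mPo [tuple 'X_i + (l i)%:MP | i < m].

HB.instance Definition _ l := GRing.RMorphism.copy (translate l)
  (comp_mpoly [tuple 'X_i + (l i)%:MP | i < m]).

Lemma translateX l i : translate l 'X_i = 'X_i + (l i)%:MP.
Proof. by rewrite /translate comp_mpolyXU -tnth_nth tnth_mktuple. Qed.

Lemma translateC l c : translate l c%:MP = c%:MP.
Proof. exact: comp_mpolyC. Qed.

Lemma translateK l p : translate (fun i => - l i) (translate l p) = p.
Proof.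
elim/mpolyind: p => [|c k p _ _ IH]; first by rewrite !rmorph0.
rewrite !rmorphD /= IH -mul_mpolyC !rmorphM /= !translateC mpolyXE_id; congr (_ * _ + _).
rewrite !rmorph_prod; apply: eq_bigr => i _.
by rewrite !rmorphXn /= translateX rmorphD /= translateX translateC -addrA -mpolyCD
           addNr mpolyC0 addr0.
Qed.

Lemma degX_le_translate l p i : degX_le i 1 p -> degX_le i 1 (translate l p).
Proof.
move=> p1; rewrite /translate comp_mpolyEX.
rewrite big_seq; apply: degX_le_sum => k /p1 ki.
rewrite comp_mpolyX -mul_mpolyC -[X in degX_le _ X]add0n.
apply: degX_leM; first exact: degX_leC.
apply: (@degX_le_trans _ _ _ (\sum_j k j * (j == i))).
  rewrite (bigD1 i) //= eqxx muln1 big1 ?addn0 // => j /negPf->.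
  by rewrite muln0.
apply: degX_le_prod => j _; rewrite tnth_mktuple; apply: degX_le_exp.
by apply: degX_leD; [apply: degX_leX | apply: degX_leC].
Qed.

End Translate.

Lemma det_1addmx_mulC (R : comNzRingType) m n (X : 'M[R]_(m, n)) (Y : 'M[R]_(n, m)) :
  \det (1%:M + X *m Y) = \det (1%:M + Y *m X).
Proof.
have E : block_mx 1%:M (- X) 0 1%:M *m block_mx (1%:M + X *m Y) 0 Y 1%:M
       = block_mx 1%:M 0 Y 1%:M *m block_mx 1%:M (- X) 0 (1%:M + Y *m X).
  rewrite !mulmx_block !(mul1mx, mulmx1, mul0mx, mulmx0, addr0, add0r) mulNmx addrK.
  by rewrite mulmxN addrCA addNr addr0.
move/(congr1 determinant): E.
by rewrite !det_mulmx !(det_ublock, det_lblock) !det1 !(mul1r, mulr1).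
Qed.

Section NormalForm.

Variables (F : finFieldType) (m : nat).
Hypothesis charF2 : 2%N \in [pchar F].
Implicit Types (l : 'I_m -> F) (B : 'M[F]_m).

Definition translate_row l : 'rV[{mpoly F[m]}]_m := \row_i ('X_i - (l i)%:MP).

(* Modulo the squares of the [x_i - l_i], the determinant of a symmetric matrix
   only depends on its diagonal and on the values of its entries at [l]; so
   [A] may be replaced with [A0 + V *m diag_mx (x - l) *m V^T], where
   [A0] is the value of [A] at [l] and [V k i] tells whether [A k k = x_i]. *)
Lemma symmetric_representation_normal_form (P : {mpoly F[m]}) n
    (A : 'M[entry F m]_n) l :
    multilinear P -> symmetric_representation P A -> P.@[l] != 0 ->
  exists2 B, B^T = B &
    P = (P.@[l])%:MP *
        \det (1%:M + diag_mx (translate_row l) *m map_mx (@mpolyC m F) B).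
Proof.
move=> Pml [Asym Adet] Pl.
pose M := map_mx (@poly_of_entry F m) A.
pose A0 := map_mx (meval l) M.
have A0det : \det A0 = P.@[l] by rewrite det_map_mx Adet.
have A0unit : A0 \in unitmx by rewrite unitmxE A0det unitfE.
have A0sym : A0^T = A0 by rewrite !map_trmx Asym.
pose V : 'M[F]_(n, m) := \matrix_(k, i) (A k k == inr i)%:R.
pose B := V^T *m invmx A0 *m V.
exists B; first by rewrite !trmx_mul trmxK trmx_inv A0sym mulmxA.
pose c := @mpolyC m F; pose D : 'M[{mpoly F[m]}]_m := diag_mx (\row_i 'X_i).
pose N := map_mx c A0 + map_mx c V *m D *m (map_mx c V)^T.
have Ndet : \det N = c P.@[l] * \det (1%:M + D *m map_mx c B).
  have -> : N = map_mx c A0 *m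
      (1%:M + map_mx c (invmx A0 *m V) *m (D *m (map_mx c V)^T)).
    have A0V : map_mx c A0 *m map_mx c (invmx A0 *m V) = map_mx c V.
      by rewrite -map_mxM (mulKVmx A0unit).
    by rewrite mulmxDr mulmx1 [in RHS]mulmxA A0V /N -mulmxA.
  rewrite det_mulmx det_map_mx A0det det_1addmx_mulC -mulmxA.
  have -> : map_mx c B = (map_mx c V)^T *m map_mx c (invmx A0 *m V).
    by rewrite map_trmx -map_mxM mulmxA.
  by [].
have Me k k' : M k k' = poly_of_entry (A k k') by rewrite mxE.
have tr0 e : (translate l (poly_of_entry e))@_0%MM = (poly_of_entry e).@[l] :> F.
  case: e => [a|i] /=; first by rewrite translateC mevalC mcoeffC eqxx mulr1.
  rewrite translateX mevalXU mcoeffD mcoeffC eqxx mulr1 mcoeffX.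
  by rewrite mnm1_eq0 add0r.
have eqlMN : eqml (translate l P) (\det N).
  rewrite -Adet -det_map_mx; apply: eqml_det_pchar2 => //.
  - by rewrite !map_trmx Asym.
  - by rewrite linearD /= !trmx_mul trmxK tr_diag_mx map_trmx A0sym mulmxA.
  - move=> k; rewrite !mxE.
    under eq_bigr do rewrite mul_mx_diag !mxE /c.
    case: (A k k) => [a|i] /=.
      by rewrite translateC mevalC big1 ?addr0 // => j _; rewrite mpolyC0 !mul0r.
    rewrite translateX mevalXU addrC (bigD1 i) //= eqxx mpolyC1 mul1r mulr1.
    rewrite big1 ?addr0 // => j /negPf ji.
    by rewrite -[inr i == inr j]/(i == j) eq_sym ji mpolyC0 !mul0r.
  - move=> i j; rewrite mxE Me tr0 !mxE mcoeffD mcoeffC eqxx mulr1.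
    rewrite raddf_sum big1 ?addr0 // => k _ /=.
    rewrite mul_mx_diag !mxE !rmorphM /= !mcoeffX mnm1_eq0.
    by rewrite mulr0 mul0r.
have degDB i : degX_le i 1 (\det (1%:M + D *m map_mx c B)).
  apply: (@degX_le_trans _ _ _ (\sum_r (r == i))).
    by rewrite (bigD1 i) //= eqxx big1 ?addn0 // => j /negPf->.
  apply: degX_le_det => r s; rewrite mul_diag_mx !mxE; apply: degX_leD.
    by rewrite -mpolyC_nat; apply: degX_leC.
  rewrite -[X in degX_le _ X]addn0; apply: degX_leM; last exact: degX_leC.
  exact: degX_leX.
have trP : translate l P = c P.@[l] * \det (1%:M + D *m map_mx c B).
  apply: eqml_multilinear_eq => [i|i|]; last by rewrite -Ndet.
    by apply: degX_le_translate => k kP; apply: Pml.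
  by rewrite -[X in degX_le _ X]add0n; apply: degX_leM; first exact: degX_leC.
rewrite -[P in LHS](translateK l) trP rmorphM /= translateC -det_map_mx.
congr (_ * \det _); apply/matrixP => i j.
rewrite mxE [in LHS]mxE [RHS]mxE !mul_diag_mx rmorphD; congr (_ + _).
  by rewrite !mxE rmorph_nat.
by rewrite !mxE rmorphM /= translateX !translateC mpolyCN.
Qed.

End NormalForm.

Lemma det_mx2 (R : comNzRingType) (M : 'M[R]_2) :
  \det M = M 0 0 * M 1 1 - M 0 1 * M 1 0.
Proof.
rewrite (expand_det_row _ 0) !big_ord_recl big_ord0 addr0 /cofactor !det_mx11 !mxE /=.
rewrite /bump /= expr0 expr1 !mul1r mulN1r mulrN.
by congr (_ * M _ _ - M _ _ * M _ _); apply/val_inj.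
Qed.

Section UpdateDeterminant.

Variables (R : comNzRingType) (m : nat) (B : 'M[R]_m).

Lemma det_1add_delta1 i : \det (1%:M + diag_mx (delta_mx 0 i) *m B) = 1 + B i i.
Proof.
have -> : diag_mx (delta_mx 0 i)
        = delta_mx i (0 : 'I_1) *m delta_mx (0 : 'I_1) i :> 'M[R]_m.
  apply/matrixP=> r s; rewrite !mxE big_ord1 !mxE eqxx andbT /= -natrM mulnb.
  have [->|rs] := eqVneq r s; first by rewrite andbb.
  by rewrite mulr0n; case: eqP => // <-; rewrite eq_sym (negPf rs).
rewrite -mulmxA det_1addmx_mulC det_mx11 mxE mxE eqxx; congr (_ + _).
by rewrite -colE -rowE !mxE.
Qed.

Lemma det_1add_delta2 i j :
  \det (1%:M + diag_mx (delta_mx 0 i + delta_mx 0 j) *m B)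
  = (1 + B i i) * (1 + B j j) - B i j * B j i.
Proof.
pose W : 'M[R]_(m, 2) := \matrix_(r, a) (r == if a == 0 then i else j)%:R.
have -> : diag_mx (delta_mx 0 i + delta_mx 0 j) = W *m W^T :> 'M[R]_m.
  apply/matrixP=> r s; rewrite !mxE !big_ord_recl big_ord0 !mxE /= addr0. 
  rewrite -!natrM !mulnb; have [->|rs] := eqVneq r s; first by rewrite mulr1n !andbb.
  have rsF k : (r == k) && (s == k) = false.
    by apply: contraNF rs => /andP[/eqP-> /eqP->].
  by rewrite mulr0n !rsF addr0.
rewrite -mulmxA det_1addmx_mulC.
have WE a b : (W^T *m B *m W) a b = B (if a == 0 then i else j) (if b == 0 then i else j).
  rewrite !mxE (bigD1 (if b == 0 then i else j)) //= [X in _ + X]big1; last first.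
    by move=> s /negPf sb; rewrite !mxE sb mulr0.
  rewrite !mxE eqxx mulr1 addr0 (bigD1 (if a == 0 then i else j)) //= big1.
    by rewrite !mxE eqxx mul1r addr0.
  by move=> s /negPf sa; rewrite !mxE sa mul0r.
have ME a b : (1%:M + W^T *m B *m W) a b
            = (a == b)%:R + B (if a == 0 then i else j) (if b == 0 then i else j).
  by rewrite mxE WE mxE.
by rewrite det_mx2 !ME /= !add0r.
Qed.

End UpdateDeterminant.

Lemma det_block_mx1 (R : comNzRingType) n1 n2 (B : 'M[R]_(n1, n2)) C D :
  \det (block_mx 1%:M B C D) = \det (D - C *m B).
Proof.
have -> : block_mx 1%:M B C D
        = block_mx 1%:M 0 C 1%:M *m block_mx 1%:M B 0 (D - C *m B).
  rewrite mulmx_block !(mul1mx, mulmx1, mul0mx, mulmx0, addr0).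
  by rewrite addrC subrK.
by rewrite det_mulmx det_lblock det_ublock !det1 !mul1r.
Qed.

Lemma det_block_mx11_pchar2 (R : idomainType) n (X B : 'M[R]_n) :
  2%N \in [pchar R] -> \det (block_mx X 1%:M 1%:M B) = \det (1%:M + X *m B).
Proof.
move=> charR; pose J : 'M[R]_(n + n) := block_mx 0 1%:M 1%:M 0.
have detJ : \det J = 1.
  have JJ : J *m J = 1%:M.
    rewrite mulmx_block !(mul1mx, mulmx0, mul0mx, addr0, add0r).
    by rewrite -scalar_mx_block.
  have /eqP : \det J ^+ 2 = 1 by rewrite expr2 -det_mulmx JJ det1.
  by rewrite sqrf_eq1 (oppr_pchar2 charR) orbb => /eqP.
have JM : J *m block_mx X 1%:M 1%:M B = block_mx 1%:M B X 1%:M.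
  by rewrite mulmx_block !(mul1mx, mulmx1, mul0mx, addr0, add0r).
have := congr1 determinant JM; rewrite det_mulmx detJ mul1r => ->.
rewrite det_block_mx1; congr (\det (_ + _)); apply/matrixP=> i j.
by rewrite mxE (oppr_pchar2 charR).
Qed.

Section Output.

Variables (F : finFieldType) (m : nat).
Hypothesis charF2 : 2%N \in [pchar F].

Definition bump_point (l : 'I_m -> F) (i : 'I_m) := fun k => l k + (k == i)%:R.

(* With the matrix [B] of the normal form and [c], [a], [b], [d] the values of [P]
   at [l], [l + e_i], [l + e_j], [l + e_i + e_j], one has [a = c (1 + B_ii)],
   [b = c (1 + B_jj)] and [d = c ((1 + B_ii) (1 + B_jj) + B_ij ^ 2)]; the root below is
   then [B_ij], also when [i = j]. *)
Definition pivot_entry (c a b d : F) : F :=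
  odflt 0 [pick z | z ^+ 2 == d / c + a * b / c ^+ 2].

Definition pivot_mx (P : {mpoly F[m]}) (l : 'I_m -> F) : 'M[F]_m :=
  \matrix_(i, j) pivot_entry P.@[l] P.@[bump_point l i] P.@[bump_point l j]
                   P.@[bump_point (bump_point l i) j].

Lemma pivot_entryE c z a b d :
  c != 0 -> z ^+ 2 = d / c + a * b / c ^+ 2 -> pivot_entry c a b d = z.
Proof.
move=> c0 zE; rewrite /pivot_entry -zE.
case: pickP => [w /eqP/esym wz|/(_ z)]; last by rewrite eqxx.
apply/eqP; rewrite eq_sym -subr_eq0 -sqrf_eq0 sqrrB wz.
by rewrite -mulr_natr (pcharf0 charF2) mulr0 subr0 addrr_pchar2.
Qed.

Lemma pivot_entryC c a b d : pivot_entry c a b d = pivot_entry c b a d.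
Proof. by rewrite /pivot_entry [a * b]mulrC. Qed.

Lemma pivot_mx_sym P l : (pivot_mx P l)^T = pivot_mx P l.
Proof.
apply/matrixP=> i j; rewrite !mxE pivot_entryC; congr pivot_entry.
by apply: meval_eq => k; rewrite /bump_point addrAC.
Qed.

Lemma normal_form_pivot_mx (P : {mpoly F[m]}) n (A : 'M[entry F m]_n) l :
    multilinear P -> symmetric_representation P A -> P.@[l] != 0 ->
  P = (P.@[l])%:MP *
      \det (1%:M + diag_mx (translate_row l) *m map_mx (@mpolyC m F) (pivot_mx P l)).
Proof.
move=> Pml AP Pl; have [B Bsym PE] := symmetric_representation_normal_form charF2 Pml AP Pl.
suff -> : pivot_mx P l = B by [].
have evalE v (u : 'rV[F]_m) : (forall k, v k = l k + u 0 k) ->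
    P.@[v] = P.@[l] * \det (1%:M + diag_mx u *m B).
  move=> vE; rewrite {1}PE mevalM mevalC -det_map_mx; congr (_ * \det _).
  apply/matrixP=> i j; rewrite mxE [in LHS]mxE [RHS]mxE !mul_diag_mx !mxE.
  by rewrite /= mevalD mevalM mevalB mevalXU !mevalC vE addrAC subrr add0r rmorph_nat.
have E1 i : P.@[bump_point l i] = P.@[l] * (1 + B i i).
  by rewrite (evalE _ (delta_mx 0 i)) ?det_1add_delta1 // => k; rewrite mxE eqxx.
apply/matrixP=> i j; rewrite mxE; apply: pivot_entryE => //.
rewrite !E1 (evalE _ (delta_mx 0 i + delta_mx 0 j)); last first.
  by move=> k; rewrite !mxE !eqxx addrA.
rewrite det_1add_delta2 -[in B j i]Bsym mxE (oppr_pchar2 charF2).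
set x := 1 + B i i; set y := 1 + B j j; set z := B i j.
have -> : P.@[l] * (x * y + z * z) / P.@[l] + P.@[l] * x * (P.@[l] * y) / P.@[l] ^+ 2
        = z ^+ 2 + (x * y + x * y) by field.
by rewrite addrr_pchar2 // addr0.
Qed.

(* The output is the symmetric matrix [c (+) [[I, L, 0], [L, X, I], [0, I, B]]] with
   [L = diag l] and [X = diag x]. *)
Definition vertex : Type := (unit + ('I_m + ('I_m + 'I_m)))%type.

Definition output_entry (S : 'I_m -> bool) (c : F) (B : 'M[F]_m) (u v : vertex)
    : entry F m :=
  match u, v with
  | inl _, inl _ => inl c
  | inr (inl i), inr (inl j) => inl (i == j)%:R
  | inr (inl i), inr (inr (inl j)) => inl ((i == j) && S i)%:R
  | inr (inr (inl i)), inr (inl j) => inl ((i == j) && S i)%:R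
  | inr (inr (inl i)), inr (inr (inl j)) => if i == j then inr i else inl 0
  | inr (inr (inl i)), inr (inr (inr j)) => inl (i == j)%:R
  | inr (inr (inr i)), inr (inr (inl j)) => inl (i == j)%:R
  | inr (inr (inr i)), inr (inr (inr j)) => inl (B i j)
  | _, _ => inl 0
  end.

Definition vertex_of_ord (k : 'I_(1 + (m + (m + m)))) : vertex :=
  match split k with
  | inl _ => inl tt
  | inr k1 => inr (match split k1 with inl i => inl i | inr k2 => inr (split k2) end)
  end.

Definition output_mx S c B : 'M[entry F m]_(1 + (m + (m + m))) :=
  \matrix_(r, s) output_entry S c B (vertex_of_ord r) (vertex_of_ord s).

Lemma output_mx_sym S c B : B^T = B -> (output_mx S c B)^T = output_mx S c B.
Proof.
move=> Bsym; apply/matrixP=> r s; rewrite !mxE.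
case: (vertex_of_ord r) (vertex_of_ord s) => [[]|[i|[i|i]]] [[]|[j|[j|j]]] //=;
  rewrite ?[j == i]eq_sym //.
- by case: eqVneq => // ->.
- by case: eqVneq => // ->.
- by case: eqVneq => // ->.
- by rewrite -[in B j i]Bsym mxE.
Qed.

Lemma det_output_mx (S : 'I_m -> bool) c (B : 'M[F]_m) :
  \det (map_mx (@poly_of_entry F m) (output_mx S c B))
  = c%:MP * \det (1%:M + diag_mx (translate_row (fun i => (S i)%:R))
                          *m map_mx (@mpolyC m F) B).
Proof.
pose X : 'M[{mpoly F[m]}]_m := diag_mx (\row_i 'X_i).
pose L : 'M[{mpoly F[m]}]_m := diag_mx (\row_i (S i)%:R).
pose Bp := map_mx (@mpolyC m F) B.
have -> : map_mx (@poly_of_entry F m) (output_mx S c B) =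
    block_mx (c%:MP)%:M 0 0
      (block_mx 1%:M (row_mx L 0) (col_mx L 0) (block_mx X 1%:M 1%:M Bp)).
  apply/matrixP=> r s; rewrite !mxE /vertex_of_ord.
  case: (split r) => [r0|r1]; rewrite !mxE; case: (split s) => [s0|s1] //=.
  - by rewrite !ord1 !mxE mulr1n.
  - by rewrite mxE mpolyC0.
  - rewrite mxE -mpolyC0; case: (split r1) => [?|r2] //.
    by case: (split r2).
  rewrite !mxE.
  case: (split r1) => [i|r2]; rewrite !mxE; case: (split s1) => [j|s2] //=.
  - by rewrite mxE rmorph_nat.
  - rewrite !mxE; case: (split s2) => [j|j] /=; rewrite !mxE ?mpolyC0 //.
    by case: eqVneq => _ /=; rewrite rmorph_nat.
  - rewrite !mxE; case: (split r2) => [i|i] /=; rewrite !mxE ?mpolyC0 //.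
    by case: eqVneq => [->|_] /=; rewrite rmorph_nat.
  rewrite !mxE; case: (split r2) => [i|i]; rewrite !mxE; case: (split s2) => [j|j] /=;
    rewrite !mxE ?rmorph_nat //.
  by case: eqVneq => [->|_] //=; rewrite ?mpolyC0.
have charP := pchar2_mpoly m charF2.
rewrite det_ublock det_scalar1; congr (_ * _).
have LL : L *m L = L.
  rewrite mulmx_diag; congr diag_mx; apply/rowP=> i; rewrite !mxE -natrM.
  by rewrite mulnb andbb.
rewrite det_block_mx1 mul_col_row !mul0mx !mulmx0 LL opp_block_mx add_block_mx !oppr0 !addr0.
have -> : diag_mx (translate_row (fun i => (S i)%:R)) = X - L.
  by apply/matrixP=> i j; rewrite !mxE rmorph_nat mulrnBl.
by rewrite (det_block_mx11_pchar2 _ _ charP).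
Qed.

End Output.

Lemma output_mx_representation (F : finFieldType) m (P : {mpoly F[m]})
    (S : 'I_m -> bool) :
    let l i : F := (S i)%:R in
    2%N \in [pchar F] -> multilinear P -> (P.@[l] = 0 -> P = 0) ->
    (exists n (A : 'M[entry F m]_n.+1), symmetric_representation P A) ->
  symmetric_representation P (output_mx S P.@[l] (pivot_mx P l)).
Proof.
move=> l charF2 Pml P0 [n [A AP]].
split; first exact/output_mx_sym/pivot_mx_sym.
rewrite det_output_mx //; have [Pl|Pl] := eqVneq P.@[l] 0.
  by rewrite Pl mpolyC0 mul0r P0.
by rewrite -(normal_form_pivot_mx charF2 Pml AP Pl).
Qed.

(** * Evaluation with a time bound *)

Definition within p env e v T := exists2 t, eval p env e v t & (t <= T)%N.

Section Within.

Variable p : program.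
Implicit Types (env : seq tree) (e : expr) (v : tree) (T : nat).

Lemma within_le env e v T T' : within p env e v T -> (T <= T')%N -> within p env e v T'.
Proof. by case=> t ev tT TT; exists t; last exact: leq_trans TT. Qed.

Lemma within_cons env e1 e2 v1 v2 T1 T2 :
  within p env e1 v1 T1 -> within p env e2 v2 T2 ->
  within p env (Cons e1 e2) (Node v1 v2) (T1 + T2).+1.
Proof. by case=> t1 ? ? [t2 ? ?]; exists (t1 + t2).+1; [constructor | rewrite ltnS leq_add]. Qed.

Lemma within_if env e e1 e2 v v' T T' :
  within p env e v' T -> within p env (if v' is Node _ _ then e1 else e2) v T' ->
  within p env (If e e1 e2) v (T + T').+1.
Proof.
case=> t1 ev1 ? [t2 ev2 ?]; exists (t1 + t2).+1; last by rewrite ltnS leq_add.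
by case: v' ev1 ev2 => [|l r] ev1 ev2; [apply: EvIfF ev1 ev2 | apply: EvIfT ev1 ev2].
Qed.

Lemma within_let env e1 e2 v1 v2 T1 T2 :
  within p env e1 v1 T1 -> within p (v1 :: env) e2 v2 T2 ->
  within p env (Let e1 e2) v2 (T1 + T2).+1.
Proof.
by case=> t1 ev1 ? [t2 ev2 ?]; exists (t1 + t2).+1; [apply: EvLet ev1 ev2 | rewrite ltnS leq_add].
Qed.

Lemma within_call env f e a v T T' :
  within p env e a T -> within p [:: a] (nth Nil p f) v T' ->
  within p env (Call f e) v (T + T').+1.
Proof.
by case=> t1 ev1 ? [t2 ev2 ?]; exists (t1 + t2).+1; [apply: EvCall ev1 ev2 | rewrite ltnS leq_add].
Qed.

Fixpoint pure e : bool :=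
  match e with
  | Var _ | Nil => true
  | Cons e1 e2 => pure e1 && pure e2
  | Hd e | Tl e => pure e
  | If e e1 e2 => [&& pure e, pure e1 & pure e2]
  | Let _ _ | Call _ _ => false
  end.

Fixpoint value env e : tree :=
  match e with
  | Var i => nth Leaf env i
  | Cons e1 e2 => Node (value env e1) (value env e2)
  | Hd e => hd (value env e)
  | Tl e => tl (value env e)
  | If e e1 e2 => if value env e is Node _ _ then value env e1 else value env e2
  | _ => Leaf
  end.

Fixpoint expr_size e : nat :=
  match e with
  | Var _ | Nil => 1
  | Cons e1 e2 | Let e1 e2 => (expr_size e1 + expr_size e2).+1
  | Hd e | Tl e | Call _ e => (expr_size e).+1
  | If e e1 e2 => (expr_size e + (expr_size e1 + expr_size e2)).+1
  end.

Lemma within_pure env e : pure e -> within p env e (value env e) (expr_size e).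
Proof.
elim: e => [i|||e IH|e IH|e IHe e1 IH1 e2 IH2||] //=.
- by exists 1; first constructor.
- by exists 1; first constructor.
- by move=> e1 IH1 e2 IH2 /andP[/IH1 ? /IH2 ?]; apply: within_cons.
- by move=> /IH[t ? ?]; exists t.+1; first constructor.
- by move=> /IH[t ? ?]; exists t.+1; first constructor.
case/and3P=> /IHe ee /IH1 e1e /IH2 e2e; apply: within_le.
  apply: within_if ee _; case: (value env e) => [|? ?]; last first.
    exact: within_le e1e (leq_addr (expr_size e2) _).
  exact: within_le e2e (leq_addl (expr_size e1) _).
by [].
Qed.

Lemma within_pure_eq env e v T :
  pure e -> value env e = v -> (expr_size e <= T)%N -> within p env e v T.
Proof. by move=> pe <-; apply: within_le; apply: within_pure. Qed.

Lemma within_val env e v :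
  pure e -> value env e = v -> within p env e v (expr_size e).
Proof. by move=> pe <-; apply: within_pure. Qed.

Lemma within_if_pure env e e1 e2 v T :
  pure e -> within p env (if value env e is Node _ _ then e1 else e2) v T ->
  within p env (If e e1 e2) v (expr_size e + T).+1.
Proof. by move=> pe; apply: within_if; apply: within_pure. Qed.

Lemma within_call_pure env f e a v T :
  pure e -> value env e = a -> within p [:: a] (nth Nil p f) v T ->
  within p env (Call f e) v (expr_size e + T).+1.
Proof. by move=> pe <-; apply: within_call; apply: within_pure. Qed.

End Within.

Fixpoint quote (t : tree) : expr :=
  if t is Node l r then Cons (quote l) (quote r) else Nil.

Lemma pure_quote t : pure (quote t).
Proof. by elim: t => //= l -> r ->. Qed.

Lemma value_quote env t : value env (quote t) = t.
Proof. by elim: t => //= l -> r ->. Qed.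

Fixpoint switch (e : expr) (bs : seq expr) : expr :=
  match bs with
  | [::] => Nil
  | [:: b] => b
  | b :: bs' => If e (switch (Tl e) bs') b
  end.

Lemma pure_switch e bs : pure e -> all pure bs -> pure (switch e bs).
Proof.
elim: bs e => //= b [|b' bs] IH e pe /andP[pb pbs] //.
by apply/and3P; split=> //; apply: IH.
Qed.

Lemma value_switch env e bs i :
  (i < size bs)%N -> value env e = enc_nat i ->
  value env (switch e bs) = value env (nth Nil bs i).
Proof.
elim: bs e i => //= b [|b' bs] IH e [|i] //= i_lt ei; rewrite ei //=.
by apply: IH => //=; rewrite ei.
Qed.

Section Tables.

Variable F : finFieldType.

Fixpoint table (es : seq expr) (g : seq F -> tree) : expr :=
  if es is e :: es' then switch e [seq table es' (fun s => g (a :: s)) | a <- enum F]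
  else quote (g [::]).

Lemma pure_table es g : all pure es -> pure (table es g).
Proof.
elim: es g => [|e es IH] g /=; first by rewrite pure_quote.
case/andP=> pe pes; apply: pure_switch => //; rewrite all_map.
by apply/allP=> a _; apply: IH.
Qed.

Lemma value_table env es g s :
  [seq value env e | e <- es] = [seq enc_scalar a | a <- s] ->
  value env (table es g) = g s.
Proof.
elim: es g s => [|e es IH] g [|a s] //= => [_|[ea ess]]; first exact: value_quote.
have a_lt : (enum_rank a < size (enum F))%N by rewrite -cardE ltn_ord.
rewrite (value_switch (i := enum_rank a)) ?size_map -?enumT //.
by rewrite (nth_map 0) // nth_enum_rank; apply: IH.
Qed.

End Tables.

(** * The program *)

Definition enc_bool (b : bool) : tree := enc_nat b.

Definition enc_bits : seq bool -> tree := enc_seq enc_bool.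

Local Notation main_fn := 0%N.
Local Notation find_fn := 1%N.
Local Notation eval_fn := 2%N.
Local Notation subset_fn := 3%N.
Local Notation add_fn := 4%N.
Local Notation flip_fn := 5%N.
Local Notation nth_fn := 6%N.
Local Notation eq_fn := 7%N.
Local Notation pivot_fn := 8%N.
Local Notation nonzero_fn := 9%N.
Local Notation vertices_fn := 10%N.
Local Notation rows_fn := 11%N.
Local Notation cols_fn := 12%N.
Local Notation entry_fn := 13%N.

Local Notation arg := (Var 0).
Local Notation Tt := (Cons Nil Nil).

Section Program.

Variable F : finFieldType.

(* (s . full): the first listed monomial at whose support the polynomial
   [full] does not vanish *)
Definition find_body :=
  If (Hd arg)
     (If (Call nonzero_fn (Call eval_fn (Cons (Tl arg) (Tl (Hd (Hd arg))))))
         (Tl (Hd (Hd arg)))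
         (Call find_fn (Cons (Tl (Hd arg)) (Tl arg))))
     Nil.

(* (s . S): the sum of the coefficients of the monomials supported in [S] *)
Definition eval_body :=
  If (Hd arg)
     (Let (Call eval_fn (Cons (Tl (Hd arg)) (Tl arg)))
          (If (Call subset_fn (Cons (Tl (Hd (Hd (Var 1)))) (Tl (Var 1))))
              (Call add_fn (Cons (Hd (Hd (Hd (Var 1)))) (Var 0)))
              (Var 0)))
     (quote (enc_scalar (0%R : F))).

Definition subset_body :=
  let next := Call subset_fn (Cons (Tl (Hd arg)) (Tl (Tl arg))) in
  If (Hd arg) (If (Hd (Hd arg)) (If (Hd (Tl arg)) next Nil) next) Tt.

Definition add_body :=
  table [:: Hd arg; Tl arg] (fun s : seq F => enc_scalar (s`_0 + s`_1)).

Definition flip_body :=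
  If (Tl arg)
     (Cons (Hd (Hd arg)) (Call flip_fn (Cons (Tl (Hd arg)) (Tl (Tl arg)))))
     (Cons (If (Hd (Hd arg)) Nil Tt) (Tl (Hd arg))).

Definition nth_body :=
  If (Tl arg) (Call nth_fn (Cons (Tl (Hd arg)) (Tl (Tl arg)))) (Hd (Hd arg)).

Definition eq_body :=
  If (Hd arg)
     (If (Tl arg) (Call eq_fn (Cons (Tl (Hd arg)) (Tl (Tl arg)))) Nil)
     (If (Tl arg) Nil Tt).

Definition pivot_body :=
  table [:: Hd arg; Hd (Tl arg); Hd (Tl (Tl arg)); Tl (Tl (Tl arg))]
        (fun s : seq F => enc_scalar (pivot_entry s`_0 s`_1 s`_2 s`_3)).

Definition nonzero_body := table [:: arg] (fun s : seq F => enc_bool (s`_0 != 0)).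

(* (tag . (i . (r . tail))): prepends the [r] vertices (tag . j) with j >= i *)
Definition vertices_body :=
  If (Hd (Tl (Tl arg)))
     (Cons (Cons (Hd arg) (Hd (Tl arg)))
           (Call vertices_fn
              (Cons (Hd arg) (Cons (Cons Nil (Hd (Tl arg)))
                 (Cons (Tl (Hd (Tl (Tl arg)))) (Tl (Tl (Tl arg))))))))
     (Tl (Tl (Tl arg))).

(* (ctx . (us . vs)), where ctx = (s . (S . c)) *)
Definition rows_body :=
  If (Hd (Tl arg))
     (Cons (Call cols_fn (Cons (Hd arg) (Cons (Hd (Hd (Tl arg))) (Tl (Tl arg)))))
           (Call rows_fn (Cons (Hd arg) (Cons (Tl (Hd (Tl arg))) (Tl (Tl arg))))))
     Nil.

Definition cols_body :=
  If (Tl (Tl arg))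
     (Cons (Call entry_fn (Cons (Hd arg) (Cons (Hd (Tl arg)) (Hd (Tl (Tl arg))))))
           (Call cols_fn (Cons (Hd arg) (Cons (Hd (Tl arg)) (Tl (Tl (Tl arg)))))))
     Nil.

Definition scalar_expr (a : F) := Cons Nil (quote (enc_scalar a)).

(* Up to [entry_body], the argument is (ctx . (u . v)). *)
Definition if_same_index e :=
  If (Call eq_fn (Cons (Tl (Hd (Tl arg))) (Tl (Tl (Tl arg))))) e (scalar_expr 0).

Definition shift_expr :=
  If (Call nth_fn (Cons (Hd (Tl (Hd arg))) (Tl (Hd (Tl arg)))))
     (scalar_expr 1) (scalar_expr 0).

Definition pivot_expr :=
  let S := Hd (Tl (Hd arg)) in
  let i := Tl (Hd (Tl arg)) in
  let j := Tl (Tl (Tl arg)) in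
  let flip S i := Call flip_fn (Cons S i) in
  let eval S := Call eval_fn (Cons (Hd (Hd arg)) S) in
  Cons Nil (Call pivot_fn
    (Cons (Tl (Tl (Hd arg)))
    (Cons (eval (flip S i)) (Cons (eval (flip S j)) (eval (flip (flip S i) j)))))).

Definition entry_body :=
  let zero := scalar_expr 0 in
  let delta := if_same_index (scalar_expr 1) in
  let shift := if_same_index shift_expr in
  let var := if_same_index (Cons (quote (Node Leaf Leaf)) (Tl (Hd (Tl arg)))) in
  let row := switch (Hd (Tl (Tl arg))) in
  switch (Hd (Hd (Tl arg)))
    [:: row [:: Cons Nil (Tl (Tl (Hd arg))); zero; zero; zero];
        row [:: zero; delta; shift; zero];
        row [:: zero; shift; var; delta];
        row [:: zero; zero; delta; pivot_expr]].

Definition main_body :=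
  let block (tag : nat) tail :=
    Call vertices_fn
      (Cons (quote (enc_nat tag)) (Cons Nil (Cons (Hd (Var 2)) tail))) in
  Let (Call find_fn (Cons (Tl arg) (Tl arg)))
 (Let (Call eval_fn (Cons (Tl (Var 1)) (Var 0)))
 (Let (Cons (Cons Nil Nil) (block 1%N (block 2%N (block 3%N Nil))))
      (Call rows_fn (Cons (Cons (Tl (Var 3)) (Cons (Var 2) (Var 1)))
                          (Cons (Var 0) (Var 0)))))).

Definition prog : program :=
  [:: main_body; find_body; eval_body; subset_body; add_body; flip_body; nth_body;
      eq_body; pivot_body; nonzero_body; vertices_body; rows_body; cols_body;
      entry_body].

Fixpoint bits_subset (u T : seq bool) : bool :=
  if u is b :: u' then (b ==> head false T) && bits_subset u' (behead T) else true.

Definition bits_flip (T : seq bool) (i : nat) := set_nth false T i (~~ nth false T i).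

Lemma bits_flipS T i :
  bits_flip T i.+1 = head false T :: bits_flip (behead T) i.
Proof. by case: T => //=; rewrite /bits_flip !nth_nil; case: i. Qed.

Lemma hd_enc_bits T : hd (enc_bits T) = enc_bool (head false T).
Proof. by case: T. Qed.

Lemma tl_enc_bits T : tl (enc_bits T) = enc_bits (behead T).
Proof. by case: T. Qed.

Lemma within_subset u T :
  within prog [:: Node (enc_bits u) (enc_bits T)] subset_body
         (enc_bool (bits_subset u T)) (30 * (size u).+1).
Proof.
elim: u T => [|b u IH] T.
  by apply: within_le; [apply: within_if_pure => //=; apply: within_val |].
set env := [:: _].
have next : within prog env (Call subset_fn (Cons (Tl (Hd arg)) (Tl (Tl arg))))
    (enc_bool (bits_subset u (behead T))) (30 * (size u).+1 + 10).
  apply: within_le.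
    apply: within_call_pure; last exact: IH.
      by [].
    by rewrite /= tl_enc_bits.
  by rewrite /=; lia.
case: b @env next => env next.
  case E: (head false T).
    apply: within_le; first apply: within_if_pure => //=.
      apply: within_if_pure => //=; apply: within_if_pure => //=.
      by rewrite hd_enc_bits E; apply: next.
    by rewrite /=; lia.
  apply: within_le; first apply: within_if_pure => //=.
    apply: within_if_pure => //=; apply: within_if_pure => //=.
    by rewrite hd_enc_bits E; apply: within_val.
  by rewrite /=; lia.
apply: within_le; first apply: within_if_pure => //=.
  by apply: within_if_pure => //=; apply: next.
by rewrite /=; lia.
Qed.

Lemma within_flip T i :
  within prog [:: Node (enc_bits T) (enc_nat i)] flip_body
         (enc_bits (bits_flip T i)) (30 * i.+1).
Proof.
elim: i T => [|i IH] T.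
  apply: within_le; first by apply: within_if_pure => //=; apply: within_val => //=;
    case: T => [|[] T].
  by [].
apply: within_le; first apply: within_if_pure => //=.
  rewrite bits_flipS; apply: within_cons.
    by apply: within_val => //=; rewrite hd_enc_bits.
  by apply: within_call_pure; last exact: IH; rewrite //= tl_enc_bits.
by rewrite /=; lia.
Qed.

Lemma within_nth T i :
  within prog [:: Node (enc_bits T) (enc_nat i)] nth_body
         (enc_bool (nth false T i)) (30 * i.+1).
Proof.
elim: i T => [|i IH] T.
  by apply: within_le; first by apply: within_if_pure => //=; apply: within_val => //=;
     rewrite hd_enc_bits nth0.
apply: within_le; first apply: within_if_pure => //=.
  rewrite -nth_behead; by apply: within_call_pure; last exact: IH; rewrite //= tl_enc_bits.
by rewrite /=; lia.
Qed.

Lemma within_eq i j :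
  within prog [:: Node (enc_nat i) (enc_nat j)] eq_body (enc_bool (i == j)) (30 * i.+1).
Proof.
elim: i j => [|i IH] [|j].
- by apply: within_le; first by do 2!apply: within_if_pure => //=; apply: within_val.
- by apply: within_le; first by do 2!apply: within_if_pure => //=; apply: within_val.
- apply: within_le; first by do 2!apply: within_if_pure => //=; apply: within_val.
  by rewrite /=; lia.
apply: within_le; first do 2!apply: within_if_pure => //=.
  by apply: within_call_pure; last exact: IH.
by rewrite /=; lia.
Qed.

Definition table_cost :=
  (expr_size add_body + expr_size pivot_body + expr_size nonzero_body
   + expr_size (quote (enc_scalar (0%R : F))) + expr_size (quote (enc_scalar (1%R : F))))%N.

Lemma table_cost_zero : (expr_size (quote (enc_scalar (0%R : F))) <= table_cost)%N.
Proof. by rewrite /table_cost; lia. Qed.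

Lemma table_cost_one : (expr_size (quote (enc_scalar (1%R : F))) <= table_cost)%N.
Proof. by rewrite /table_cost; lia. Qed.

Lemma table_cost_scalar (a : F) : (a == 0) || (a == 1) ->
  (expr_size (quote (enc_scalar a)) <= table_cost)%N.
Proof. by case/orP=> /eqP->; [exact: table_cost_zero | exact: table_cost_one]. Qed.

Lemma within_add (a b : F) :
  within prog [:: Node (enc_scalar a) (enc_scalar b)] add_body (enc_scalar (a + b))
         table_cost.
Proof.
apply: within_pure_eq; first exact: pure_table.
  exact: (@value_table _ _ _ _ [:: a; b]).
by rewrite /table_cost; lia.
Qed.

Lemma within_pivot (c a b d : F) :
  within prog
    [:: Node (enc_scalar c) (Node (enc_scalar a) (Node (enc_scalar b) (enc_scalar d)))]
    pivot_body (enc_scalar (pivot_entry c a b d)) table_cost.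
Proof.
apply: within_pure_eq; first exact: pure_table.
  exact: (@value_table _ _ _ _ [:: c; a; b; d]).
by rewrite /table_cost; lia.
Qed.

Lemma within_nonzero (a : F) :
  within prog [:: enc_scalar a] nonzero_body (enc_bool (a != 0)) table_cost.
Proof.
apply: within_pure_eq; first exact: pure_table.
  exact: (@value_table _ _ _ _ [:: a]).
by rewrite /table_cost; lia.
Qed.

Lemma within_vertices tag i r tail :
  within prog [:: Node tag (Node (enc_nat i) (Node (enc_nat r) tail))] vertices_body
    (foldr (fun j t => Node (Node tag (enc_nat j)) t) tail (iota i r)) (50 * r.+1).
Proof.
elim: r i => [|r IH] i.
  by apply: within_le; first by apply: within_if_pure => //=; apply: within_val.
apply: within_le; first apply: within_if_pure => //=.
  apply: within_cons; first by apply: within_val.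
  by apply: within_call_pure; last exact: IH.
by rewrite /=; lia.
Qed.

Definition entry_cost (m k : nat) : nat :=
  (3 * (k.+1 * (30 * m.+1 + table_cost + 60)) + 200 * m.+1 + 2 * table_cost + 300)%N.

Definition main_cost (m k : nat) : nat :=
  (k.+1 * (k.+1 * (30 * m.+1 + table_cost + 60) + table_cost + 60)
   + k.+1 * (30 * m.+1 + table_cost + 60) + 150 * m.+1
   + (3 * m + 2) * ((3 * m + 2) * (entry_cost m k + 40) + 40) + 300)%N.

Section Polynomial.

Variables (m : nat) (P : {mpoly F[m]}).
Implicit Types s : seq 'X_{1..m}.

Definition enc_terms s :=
  enc_seq (fun mon => Node (enc_scalar P@_mon) (enc_monomial mon)) s.

Definition support_bits (mon : 'X_{1..m}) : seq bool :=
  [seq mon i != 0%N | i <- enum 'I_m].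

Definition sum_subset s (T : seq bool) : F :=
  \sum_(mon <- s) if bits_subset (support_bits mon) T then P@_mon else 0.

Fixpoint find_support full s : seq bool :=
  if s is mon :: s' then
    if sum_subset full (support_bits mon) != 0 then support_bits mon
    else find_support full s'
  else [::].

Definition squarefree s := forall mon, mon \in s -> forall i, (mon i <= 1)%N.

Lemma enc_monomialE (mon : 'X_{1..m}) :
  (forall i, (mon i <= 1)%N) -> enc_monomial mon = enc_bits (support_bits mon).
Proof.
move=> mon1; rewrite /enc_monomial /enc_bits /support_bits.
by elim: (enum 'I_m) => //= i e ->; case: (mon i) (mon1 i) => [|[]].
Qed.

Lemma squarefree_cons mon s :
  squarefree (mon :: s) -> (forall i, (mon i <= 1)%N) /\ squarefree s.
Proof.
move=> sf; split; first by apply: sf; rewrite mem_head.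
by move=> k ks; apply: sf; rewrite inE ks orbT.
Qed.

Lemma within_eval s T : squarefree s ->
  within prog [:: Node (enc_terms s) (enc_bits T)] eval_body
    (enc_scalar (sum_subset s T)) ((size s).+1 * (30 * m.+1 + table_cost + 60)).
Proof.
elim: s => [|mon s IH] sf.
  rewrite /sum_subset big_nil; apply: within_le.
    apply: within_if_pure => //=; apply: within_val; rewrite ?value_quote //.
    exact: pure_quote.
  by have := table_cost_zero; rewrite /=; lia.
have [mon1 /IH {}IH] := squarefree_cons sf.
rewrite /sum_subset big_cons -/(sum_subset s T).
apply: within_le.
  apply: within_if_pure => //=; apply: within_let.
    by apply: within_call_pure; last exact: IH.
  apply: within_if.
    apply: within_call_pure; last exact: (within_subset (support_bits mon) T).
      by [].
    by rewrite /= enc_monomialE.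
  apply: (@within_le _ _ _ _ (table_cost + 10)); last by [].
  case: (bits_subset _ _); last by rewrite add0r; apply: within_pure_eq => //=; lia.
  apply: within_le; first by apply: within_call_pure; last exact: within_add.
  by rewrite /=; lia.
by rewrite size_map size_enum_ord /=; lia.
Qed.

Lemma within_find full s : squarefree full -> squarefree s ->
  within prog [:: Node (enc_terms s) (enc_terms full)] find_body
    (enc_bits (find_support full s))
    ((size s).+1 * ((size full).+1 * (30 * m.+1 + table_cost + 60)
                    + table_cost + 60)).
Proof.
move=> full_sf; elim: s => [|mon s IH] sf.
  by apply: within_le; [apply: within_if_pure => //=; apply: within_val | rewrite /=; lia].
have [mon1 /IH {}IH] := squarefree_cons sf.
set Ev := ((size full).+1 * _)%N in IH *.
apply: (@within_le _ _ _ _ (Ev + table_cost + 60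
   + (size s).+1 * (Ev + table_cost + 60))); last by rewrite /= [in leqRHS]mulSn.
have eval_mon : within prog [:: Node (enc_terms (mon :: s)) (enc_terms full)]
    (Call nonzero_fn (Call eval_fn (Cons (Tl arg) (Tl (Hd (Hd arg))))))
    (enc_bool (sum_subset full (support_bits mon) != 0)) (Ev + table_cost + 10).
  apply: within_le.
    apply: within_call; last exact: within_nonzero.
    apply: within_call_pure; last exact: (within_eval (support_bits mon) full_sf).
      by [].
    by rewrite /= enc_monomialE.
  by rewrite /=; lia.
apply: within_le; first apply: within_if_pure => //=.
  apply: within_if; first exact: eval_mon.
  apply: (@within_le _ _ _ _ ((size s).+1 * (Ev + table_cost + 60) + 10)); last by [].
  case: (_ != 0); first by apply: within_pure_eq; rewrite //= ?enc_monomialE //; lia.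
  apply: within_le; first by apply: within_call_pure; last exact: IH.
  by rewrite /=; lia.
by rewrite /=; lia.
Qed.

Definition enc_vertex (u : vertex m) : tree :=
  match u with
  | inl _ => Node Leaf Leaf
  | inr (inl i) => Node (enc_nat 1%N) (enc_nat i)
  | inr (inr (inl i)) => Node (enc_nat 2%N) (enc_nat i)
  | inr (inr (inr i)) => Node (enc_nat 3%N) (enc_nat i)
  end.

Definition sum_subset_pivot_mx s (S : seq bool) : 'M[F]_m :=
  \matrix_(i, j) pivot_entry (sum_subset s S) (sum_subset s (bits_flip S i))
    (sum_subset s (bits_flip S j)) (sum_subset s (bits_flip (bits_flip S i) j)).

Lemma within_entry s (S : seq bool) (u v : vertex m) : squarefree s ->
  within prog
    [:: Node (Node (enc_terms s) (Node (enc_bits S) (enc_scalar (sum_subset s S))))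
             (Node (enc_vertex u) (enc_vertex v))]
    entry_body
    (enc_entry (output_entry (fun i => nth false S i) (sum_subset s S)
                  (sum_subset_pivot_mx s S) u v))
    (entry_cost m (size s)).
Proof.
move=> sf.
set ctx := Node (enc_terms s) (Node (enc_bits S) (enc_scalar (sum_subset s S))).
have scalar a env : (a == 0) || (a == 1) ->
    within prog env (scalar_expr a) (enc_entry (inl a : entry F m)) (table_cost + 5).
  move=> a01; apply: within_pure_eq; rewrite /= ?pure_quote ?value_quote //.
  by have := table_cost_scalar a01; lia.
have zero env : within prog env (scalar_expr 0) (enc_entry (inl 0 : entry F m)) (table_cost + 5).
  by apply: scalar; rewrite eqxx.
have same (i j : 'I_m) ti tj e (x : entry F m) T :
    within prog [:: Node ctx (Node (Node ti (enc_nat i)) (Node tj (enc_nat j)))]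
      e (enc_entry x) T -> (table_cost + 5 <= T)%N ->
    within prog [:: Node ctx (Node (Node ti (enc_nat i)) (Node tj (enc_nat j)))]
      (if_same_index e) (enc_entry (if i == j then x else inl 0)) (T + 30 * m.+1 + 20).
  move=> xT leT; apply: within_le.
    apply: within_if; first by apply: within_call_pure; last exact: (within_eq i j).
    rewrite -val_eqE; apply: (@within_le _ _ _ _ T); last by [].
    by case: eqP => _ /=; [exact: xT | apply: within_le leT; exact: zero].
  by have := ltn_ord i; rewrite /=; lia.
have delta (i j : 'I_m) ti tj :
    within prog [:: Node ctx (Node (Node ti (enc_nat i)) (Node tj (enc_nat j)))]
      (if_same_index (scalar_expr 1)) (enc_entry (inl (i == j)%:R : entry F m))
      (table_cost + 30 * m.+1 + 25).
  have -> : inl (i == j)%:R = if i == j then inl 1 else inl 0 :> entry F m by case: eqP.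
  apply: within_le; first by apply: same; [apply: scalar; rewrite eqxx orbT | ].
  by lia.
have shift (i j : 'I_m) ti tj :
    within prog [:: Node ctx (Node (Node ti (enc_nat i)) (Node tj (enc_nat j)))]
      (if_same_index shift_expr) (enc_entry (inl ((i == j) && nth false S i)%:R : entry F m))
      (table_cost + 60 * m.+1 + 50).
  have -> : inl ((i == j) && nth false S i)%:R
          = if i == j then inl (nth false S i)%:R else inl 0 :> entry F m by case: eqP.
  apply: within_le; first apply: same.
  - apply: within_if; first by apply: within_call_pure; last exact: (within_nth S i).
    apply: (@within_le _ _ _ _ (table_cost + 5)); last by [].
    by case: (nth false S i); apply: scalar; rewrite eqxx ?orbT.
  - by lia.
  by have := ltn_ord i; rewrite /=; lia.
have var (i j : 'I_m) ti tj :
    within prog [:: Node ctx (Node (Node ti (enc_nat i)) (Node tj (enc_nat j)))]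
      (if_same_index (Cons (quote (Node Leaf Leaf)) (Tl (Hd (Tl arg)))))
      (enc_entry (if i == j then inr i else inl 0 : entry F m))
      (table_cost + 30 * m.+1 + 60).
  apply: within_le.
    apply: (same i j ti tj _ _ (table_cost + 10)%N); last by lia.
    by apply: within_pure_eq => //=; lia.
  by lia.
have pivot (i j : 'I_m) ti tj :
    within prog [:: Node ctx (Node (Node ti (enc_nat i)) (Node tj (enc_nat j)))]
      pivot_expr (enc_entry (inl (sum_subset_pivot_mx s S i j) : entry F m))
      (entry_cost m (size s) - 100).
  rewrite mxE; apply: within_le.
    apply: within_cons; first exact: within_val.
    apply: within_call; last exact: within_pivot.
    apply: within_cons; first exact: within_val.
    apply: within_cons.
      apply: within_call; last exact: within_eval.
      apply: within_cons; first exact: within_val.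
      by apply: within_call_pure; last exact: (within_flip S i).
    apply: within_cons.
      apply: within_call; last exact: within_eval.
      apply: within_cons; first exact: within_val.
      by apply: within_call_pure; last exact: (within_flip S j).
    apply: within_call; last exact: within_eval.
    apply: within_cons; first exact: within_val.
    apply: within_call; last exact: (within_flip _ j).
    apply: within_cons; last exact: within_val.
    by apply: within_call_pure; last exact: (within_flip S i).
  by have := ltn_ord i; have := ltn_ord j; rewrite /entry_cost /=; lia.
case: u v => [[]|[i|[i|i]]] [[]|[j|[j|j]]].
all: apply: within_le;
  [ rewrite /entry_body /=;
    repeat (apply: within_if_pure => //=);
    first [exact: zero | exact: delta | exact: shift | exact: var | exact: pivot
          | exact: within_val] | rewrite /entry_cost /=; lia ].
Qed.

Definition entry_of s (S : seq bool) (u v : vertex m) : entry F m :=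
  output_entry (fun i => nth false S i) (sum_subset s S) (sum_subset_pivot_mx s S) u v.

Definition enc_context s (S : seq bool) : tree :=
  Node (enc_terms s) (Node (enc_bits S) (enc_scalar (sum_subset s S))).

Lemma within_cols s S u vs : squarefree s ->
  within prog
    [:: Node (enc_context s S) (Node (enc_vertex u) (enc_seq enc_vertex vs))] cols_body
    (enc_seq (fun v => enc_entry (entry_of s S u v)) vs)
    ((size vs).+1 * (entry_cost m (size s) + 40)).
Proof.
move=> sf; elim: vs => [|v vs IH].
  by apply: within_le; [apply: within_if_pure => //=; apply: within_val | rewrite /=; lia].
apply: within_le.
  apply: within_if_pure => //=; apply: within_cons.
    by apply: within_call_pure; last exact: (within_entry S u v sf).
  by apply: within_call_pure; last exact: IH.
by rewrite /=; lia.
Qed.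

Lemma within_rows s S us vs : squarefree s ->
  within prog
    [:: Node (enc_context s S) (Node (enc_seq enc_vertex us) (enc_seq enc_vertex vs))]
    rows_body
    (enc_seq (fun u => enc_seq (fun v => enc_entry (entry_of s S u v)) vs) us)
    ((size us).+1 * ((size vs).+1 * (entry_cost m (size s) + 40) + 40)).
Proof.
move=> sf; elim: us => [|u us IH].
  by apply: within_le; [apply: within_if_pure => //=; apply: within_val | rewrite /=; lia].
apply: within_le.
  apply: within_if_pure => //=; apply: within_cons.
    by apply: within_call_pure; last exact: (within_cols S u vs sf).
  by apply: within_call_pure; last exact: IH.
by rewrite /=; lia.
Qed.

Definition vertices : seq (vertex m) :=
  inl tt :: [seq inr (inl i) | i <- enum 'I_m]
    ++ [seq inr (inr (inl i)) | i <- enum 'I_m]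
    ++ [seq inr (inr (inr i)) | i <- enum 'I_m].

Lemma size_vertices : size vertices = (3 * m).+1.
Proof.
have -> : size vertices
        = (size (enum 'I_m) + (size (enum 'I_m) + size (enum 'I_m))).+1.
  by rewrite /vertices -cat1s !size_cat !size_map.
by rewrite size_enum_ord; lia.
Qed.

Lemma foldr_iota_ord tag tail :
  foldr (fun j t => Node (Node tag (enc_nat j)) t) tail (iota 0 m)
  = foldr (fun (i : 'I_m) t => Node (Node tag (enc_nat i)) t) tail (enum 'I_m).
Proof. by rewrite -val_enum_ord foldr_map. Qed.

Lemma enc_vertices :
  let block (tag : nat) tail :=
    foldr (fun (i : 'I_m) t => Node (Node (enc_nat tag) (enc_nat i)) t) tail (enum 'I_m) in
  enc_seq enc_vertex vertices = Node (Node Leaf Leaf) (block 1%N (block 2%N (block 3%N Leaf))).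
Proof.
rewrite /vertices /enc_seq -cat1s foldr_cat [foldr _ _ [:: _]]/=; congr Node.
by rewrite !foldr_cat !foldr_map.
Qed.

Lemma within_main s : squarefree s ->
  let S := find_support s s in
  within prog [:: Node (enc_nat m) (enc_terms s)] main_body
    (enc_seq (fun u => enc_seq (fun v => enc_entry (entry_of s S u v)) vertices) vertices)
    (main_cost m (size s)).
Proof.
move=> sf S; apply: within_le.
  apply: within_let.
    by apply: within_call_pure; last exact: (within_find sf sf).
  apply: within_let.
    by apply: within_call_pure; last exact: (within_eval S sf).
  have block tail env e tag T :
      nth Leaf env 2 = Node (enc_nat m) (enc_terms s) -> within prog env e tail T ->
      within prog env
        (Call vertices_fn
           (Cons (quote (enc_nat tag)) (Cons Nil (Cons (Hd (Var 2)) e))))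
        (foldr (fun (i : 'I_m) t => Node (Node (enc_nat tag) (enc_nat i)) t) tail (enum 'I_m))
        (T + expr_size (quote (enc_nat tag)) + 50 * m.+1 + 20).
    move=> env2 eT; apply: within_le.
      apply: (within_call (a := Node (enc_nat tag) (Node (enc_nat 0) (Node (enc_nat m) tail)))).
        apply: within_cons; first by apply: within_val (value_quote _ _); apply: pure_quote.
        apply: within_cons; first exact: within_val.
        by apply: within_cons eT; apply: within_val; rewrite //= env2.
      rewrite -foldr_iota_ord; exact: (within_vertices _ 0).
    by rewrite /=; lia.
  apply: (within_let (v1 := enc_seq enc_vertex vertices)).
    rewrite enc_vertices.
    apply: within_cons; first exact: within_val.
    by do 3!apply: (block) => //; apply: within_val.
  by apply: within_call_pure; last exact: (within_rows S vertices vertices sf).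
by rewrite size_vertices /main_cost /=; lia.
Qed.

End Polynomial.
End Program.

Lemma enum_ord_add a b :
  enum 'I_(a + b) = [seq lshift b i | i <- enum 'I_a] ++ [seq rshift a i | i <- enum 'I_b].
Proof.
apply: (inj_map val_inj); rewrite map_cat val_enum_ord iotaD.
rewrite -(map_comp val (@lshift a b)) -(map_comp val (@rshift a b)); congr (_ ++ _).
  by rewrite -val_enum_ord; apply: eq_map.
by rewrite -[X in iota X _](addn0 a) iotaDl -val_enum_ord -(map_comp (addn a)); apply: eq_map.
Qed.

Lemma vertices_of_ord m :
  vertices m = [seq @vertex_of_ord m k | k <- enum 'I_(1 + (m + (m + m)))].
Proof.
have splitl a b (i : 'I_a) : split (lshift b i) = inl i by exact: (unsplitK (inl i)).
have splitr a b (i : 'I_b) : split (rshift a i) = inr i by exact: (unsplitK (inr i)).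
have enum1 : enum 'I_1 = [:: ord0] by apply: (inj_map val_inj); rewrite val_enum_ord.
rewrite !enum_ord_add enum1 !map_cat /vertices -cat1s; congr (_ ++ _ ++ _ ++ _).
  by rewrite /= /vertex_of_ord splitl.
all: by elim: (enum 'I_m) => //= i l <-; rewrite /vertex_of_ord !(splitl, splitr).
Qed.

Lemma bits_subsetP u T :
  reflect (forall i, nth false u i -> nth false T i) (bits_subset u T).
Proof.
elim: u T => [|b u IH] T /=; first by apply: ReflectT => i; rewrite nth_nil.
apply: (iffP andP) => [[bT /IH uT] [|i]|uT].
- by rewrite nth0; apply/implyP.
- by move=> /uT; rewrite nth_behead.
split; first by rewrite -nth0; apply/implyP/(uT 0%N).
by apply/IH => i; rewrite nth_behead; apply: (uT i.+1).
Qed.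

Section Evaluation.

Variables (F : finFieldType) (m : nat) (P : {mpoly F[m]}) (s : seq 'X_{1..m}).
Hypothesis charF2 : 2%N \in [pchar F].
Hypotheses (Pml : multilinear P) (sP : perm_eq s (msupp P)).

Definition point (T : seq bool) (i : 'I_m) : F := (nth false T i)%:R.

Lemma squarefree_supp : squarefree s.
Proof. by move=> k ks i; apply: Pml; rewrite -(perm_mem sP). Qed.

Lemma nth_support_bits (k : 'X_{1..m}) (i : 'I_m) :
  nth false (support_bits k) i = (k i != 0%N).
Proof. by rewrite (nth_map i) ?size_enum_ord // nth_ord_enum. Qed.

Lemma support_bits_subset k T :
  bits_subset (support_bits k) T = [forall i : 'I_m, (k i != 0%N) ==> nth false T i].
Proof.
apply/bits_subsetP/forallP => kT i.
  by rewrite -nth_support_bits; apply/implyP/kT.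
have [im|im] := ltnP i m; last by rewrite nth_default // size_map size_enum_ord.
by move: (kT (Ordinal im)); rewrite -nth_support_bits => /implyP.
Qed.

Lemma sum_subset_meval T : sum_subset P s T = P.@[point T].
Proof.
rewrite mevalE -(perm_big _ sP) /=; apply: eq_big_seq => k /squarefree_supp k1.
rewrite support_bits_subset; case: forallP => [kT|/forallP].
  rewrite big1 ?mulr1 // => i _; rewrite /point.
  by case: eqVneq (kT i) => [->|_ /= ->]; rewrite ?expr0 ?expr1n.
rewrite negb_forall => /existsP[i]; rewrite negb_imply => /andP[ki Ti].
by rewrite (bigD1 i) //= /point (negPf Ti) expr0n (negPf ki) mul0r mulr0.
Qed.

Lemma point_flip T (i : 'I_m) : point (bits_flip T i) =1 bump_point (point T) i.
Proof.
move=> k; rewrite /point /bump_point nth_set_nth /= val_eqE.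
have [->|_] := eqVneq k i; last by rewrite addr0.
by case: nth; rewrite ?add0r // addrr_pchar2.
Qed.

Lemma sum_subset_pivot_mxE T : sum_subset_pivot_mx P s T = pivot_mx P (point T).
Proof.
apply/matrixP=> i j; rewrite !mxE !sum_subset_meval; congr pivot_entry.
- by apply: meval_eq => k; rewrite point_flip.
- by apply: meval_eq => k; rewrite point_flip.
by apply: meval_eq => k; rewrite point_flip /bump_point point_flip.
Qed.

Lemma find_support_neq0 full t :
    has (fun k => sum_subset P full (support_bits k) != 0) t ->
  sum_subset P full (find_support P full t) != 0.
Proof. by elim: t => //= k t IH; case: ifP. Qed.

(* At the support of a monomial of minimal degree, [P] takes the value of the
   coefficient of this monomial. *)
Lemma meval_find_support : P.@[point (find_support P s s)] = 0 -> P = 0.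
Proof.
move=> P0; apply/eqP; apply: contraLR (eqxx (P.@[point (find_support P s s)])) => PN0.
rewrite [X in _ == X]P0 -sum_subset_meval; apply: find_support_neq0.
have sN0 : exists d, has (fun k => mdeg k == d) s.
  have: s != [::] by apply: contraNneq PN0 => s0; rewrite -msupp_eq0 -size_eq0 -(perm_size sP) s0.
  by case: s => // k t _; exists (mdeg k) => /=; rewrite eqxx.
case: (ex_minnP sN0) => d /hasP[k ks /eqP kd] dmin.
apply/hasP; exists k => //; rewrite /sum_subset (bigD1_seq k) ?(perm_uniq sP) //=.
have k1 := squarefree_supp ks.
rewrite support_bits_subset ifT; last first.
  by apply/forallP=> i; rewrite nth_support_bits implybb.
rewrite big1_seq ?addr0 -?mcoeff_msupp -?(perm_mem sP) // => j /andP[jk js].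
rewrite support_bits_subset; case: forallP => // jk_sub.
have j1 := squarefree_supp js.
have le_jk : (j <= k)%MM.
  apply/mnm_lepP => i; move: (jk_sub i) (j1 i); rewrite nth_support_bits.
  by case: (j i) (k i) => [|[|?]] [|?].
have : (mdeg k <= mdeg j)%N by rewrite kd dmin //; apply/hasP; exists j.
rewrite -{1}(submK le_jk) mdegD -[leqRHS]add0n leq_add2r leqn0 mdeg_eq0 => /eqP kj0.
by case/eqP: jk; rewrite -(submK le_jk) kj0 add0m.
Qed.

End Evaluation.

Definition poly_bounded (f : nat -> nat -> nat) :=
  exists c d, forall m k, (f m k <= c * (m + k).+1 ^ d)%N.

Lemma poly_bounded_const a : poly_bounded (fun _ _ => a).
Proof. by exists a, 0%N => m k; rewrite expn0 muln1. Qed.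

Lemma poly_bounded_fst : poly_bounded (fun m _ => m).
Proof. by exists 1%N, 1%N => m k; lia. Qed.

Lemma poly_bounded_snd : poly_bounded (fun _ k => k).
Proof. by exists 1%N, 1%N => m k; lia. Qed.

Lemma poly_bounded_add f g :
  poly_bounded f -> poly_bounded g -> poly_bounded (fun m k => f m k + g m k)%N.
Proof.
move=> [c [d fd]] [c' [d' gd]]; exists (c + c')%N, (d + d')%N => m k.
rewrite mulnDl leq_add //; [apply: leq_trans (fd m k) _ | apply: leq_trans (gd m k) _];
  by rewrite leq_mul2l leq_pexp2l ?orbT ?(leq_addr, leq_addl).
Qed.

Lemma poly_bounded_mul f g :
  poly_bounded f -> poly_bounded g -> poly_bounded (fun m k => f m k * g m k)%N.
Proof.
move=> [c [d fd]] [c' [d' gd]]; exists (c * c')%N, (d + d')%N => m k.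
by rewrite expnD mulnACA leq_mul.
Qed.

Lemma poly_bounded_succ f : poly_bounded f -> poly_bounded (fun m k => (f m k).+1).
Proof.
move=> fP; have [c [d fd]] := poly_bounded_add (poly_bounded_const 1) fP.
by exists c, d => m k; apply: fd.
Qed.

Lemma poly_bounded_main_cost F : poly_bounded (main_cost F).
Proof.
rewrite /main_cost /entry_cost.
by do !first [apply: poly_bounded_const | apply: poly_bounded_fst
  | apply: poly_bounded_snd | apply: poly_bounded_succ | apply: poly_bounded_add
  | apply: poly_bounded_mul].
Qed.

Lemma enc_seq_map (T U : Type) (enc : U -> tree) (f : T -> U) t :
  enc_seq enc (map f t) = enc_seq (fun x => enc (f x)) t.
Proof. exact: foldr_map. Qed.

Lemma eq_enc_seq (T : Type) (enc enc' : T -> tree) t :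
  enc =1 enc' -> enc_seq enc t = enc_seq enc' t.
Proof. by move=> e; elim: t => //= x t ->; rewrite e. Qed.

Theorem theorem5p10 (F : finFieldType) (charF2 : 2%N \in [pchar F]) :
  exists (p : program) (c d : nat),
    forall (m : nat) (P : {mpoly F[m]}) (s : seq 'X_{1..m}),
      multilinear P -> perm_eq s (msupp P) ->
      exists (output : tree) (t : nat),
        [/\ runs p (enc_poly P s) output t,
            (t <= c * (m + size (msupp P)).+1 ^ d)%N
          & (exists (n : nat) (A : 'M[entry F m]_n.+1),
               symmetric_representation P A) ->
            exists (n : nat) (A : 'M[entry F m]_n.+1),
              symmetric_representation P A /\ output = enc_matrix A].
Proof.
have [c [d cost_le]] := poly_bounded_main_cost F.
exists (prog F), c, d => m P s Pml sP.
have [t run_t t_le] := within_main P (squarefree_supp Pml sP).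
eexists; exists t; split; first exact: run_t.
  by apply: leq_trans t_le _; rewrite (perm_size sP).
set S := find_support P s s in run_t t_le *.
move=> SDR; exists (m + (m + m))%N; pose l := @point F m S.
exists (output_mx (fun i => nth false S i) P.@[l] (pivot_mx P l)).
split; first by apply: output_mx_representation => //; apply: meval_find_support.
rewrite vertices_of_ord enc_seq_map; apply: eq_enc_seq => u.
rewrite enc_seq_map; apply: eq_enc_seq => v.
by rewrite mxE /entry_of sum_subset_meval // sum_subset_pivot_mxE.
Qed.
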